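(* For every composition $\alpha=[\alpha_1,\dots,\alpha_m]$ of $n$, the $H_n(0)$-module $\mathcal{V}_\alpha$ is indecomposable. Here $\mathcal{V}_\alpha=\mathcal{M}_\alpha/\mathcal{N}_\alpha$, where $\mathcal{M}_\alpha$ has basis the words of length $n$ with exactly $\alpha_j$ occurrences of the letter $j$ ($1\le j\le m$), with action $\pi_iw=w$ if $w_i\ge w_{i+1}$ and $\pi_iw=w_1\cdots w_{i+1}w_i\cdots w_n$ (swap positions $i,i+1$) if $w_i<w_{i+1}$, and $\mathcal{N}_\alpha$ is the submodule spanned by words that are not $\mathcal{Y}$-words.
   Context: A composition of $n$ is a tuple of positive integers summing to $n$. The $0$-Hecke algebra $H_n(0)$ is generated by $\pi_1,\dots,\pi_{n-1}$ with relations $\pi_i^2=\pi_i$, $\pi_i\pi_{i+1}\pi_i=\pi_{i+1}\pi_i\pi_{i+1}$, $\pi_i\pi_j=\pi_j\pi_i$ for $|i-j|>1$. A word is a $\mathcal{Y}$-word if for every $j$ the first occurrence of $j$ appears before the first occurrence of $j+1$. *)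

(* Defs.v *)
From HB Require Import structures.
From mathcomp Require Import all_boot all_order perm all_algebra.
From mathcomp Require Import zify.
From mathcomp Require Import boolp.

Set Implicit Arguments.
Unset Strict Implicit.
Unset Printing Implicit Defensive.

Import GRing.Theory.
Local Open Scope ring_scope.
Local Open Scope quotient_scope.

Record submodule (R : pzRingType) (M : lmodType R) := Submodule {
  submodule_pred :> {pred M};
  submodule_closed : submod_closed submodule_pred
}.

HB.instance Definition _ R M (N : @submodule R M) :=
  GRing.isSubmodClosed.Build R M (submodule_pred N) (submodule_closed N).

Section QuotientModule.
Variables (R : pzRingType) (M : lmodType R) (N : submodule M).

Definition quotmod := Quotient.quot (submodule_pred N).
HB.instance Definition _ := GRing.Zmodule.on quotmod.

Definition quotmod_scale (a : R) (x : quotmod) : quotmod :=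
  \pi_quotmod (a *: repr x).

Lemma pi_scale (a : R) (v : M) :
  quotmod_scale a (\pi v) = \pi_quotmod (a *: v).
Proof.
apply/eqP; rewrite -Quotient.idealrBE -scalerBr rpredZ //.
by rewrite Quotient.idealrBE reprK.
Qed.

Fact quotmod_scaleA a b x :
  quotmod_scale a (quotmod_scale b x) = quotmod_scale (a * b) x.
Proof.
elim/quotW: x => v.
by rewrite (pi_scale b v) (pi_scale a (b *: v)) (pi_scale (a * b) v) scalerA.
Qed.
Fact quotmod_scale1 : left_id 1 quotmod_scale.
Proof. by elim/quotW => v; rewrite (pi_scale 1 v) scale1r. Qed.
Fact quotmod_scaleDr : right_distributive quotmod_scale +%R.
Proof.
move=> a; elim/quotW => x; elim/quotW => y.
rewrite -[in LHS](raddfD \pi_quotmod) (pi_scale a (x + y)) scalerDr.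
by rewrite (pi_scale a x) (pi_scale a y) (raddfD \pi_quotmod).
Qed.
Fact quotmod_scaleDl x : {morph quotmod_scale^~ x : a b / a + b}.
Proof.
move=> a b; elim/quotW: x => x; rewrite (pi_scale (a + b) x) scalerDl.
by rewrite (pi_scale a x) (pi_scale b x) (raddfD \pi_quotmod).
Qed.

HB.instance Definition _ := GRing.Zmodule_isLmodule.Build R quotmod
  quotmod_scaleA quotmod_scale1 quotmod_scaleDr quotmod_scaleDl.

End QuotientModule.

Definition indecomposable (R : pzRingType) (V : lmodType R) : Prop :=
  (exists v : V, v != 0) /\
  forall U W : submodule V,
    (forall v, exists2 u, u \in U & exists2 w, w \in W & v = u + w) ->
    (forall v, v \in U -> v \in W -> v = 0) ->
    (forall u, u \in U -> u = 0) \/ (forall w, w \in W -> w = 0).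

(* [hecke0 K n] is the [K]-algebra presented by generators and relations:
   expressions in the generators modulo the least congruence containing the
   axioms of unital associative [K]-algebras and the 0-Hecke relations.
   The generators [pi_1, ..., pi_(n-1)] are indexed from 0 by ['I_n.-1]. *)

Section Hecke0.
Variables (K : fieldType) (n : nat).

Inductive hexpr : Type :=
| HConst of K
| HGen of 'I_n.-1
| HAdd of hexpr & hexpr
| HMul of hexpr & hexpr.

Inductive hcong : hexpr -> hexpr -> Prop :=
| hc_refl x : hcong x x
| hc_sym x y : hcong x y -> hcong y x
| hc_trans x y z : hcong x y -> hcong y z -> hcong x z
| hc_add x x' y y' : hcong x x' -> hcong y y' -> hcong (HAdd x y) (HAdd x' y')
| hc_mul x x' y y' : hcong x x' -> hcong y y' -> hcong (HMul x y) (HMul x' y')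
| hc_addA x y z : hcong (HAdd x (HAdd y z)) (HAdd (HAdd x y) z)
| hc_addC x y : hcong (HAdd x y) (HAdd y x)
| hc_add0 x : hcong (HAdd (HConst 0) x) x
| hc_addN x : hcong (HAdd (HMul (HConst (-1)) x) x) (HConst 0)
| hc_mulA x y z : hcong (HMul x (HMul y z)) (HMul (HMul x y) z)
| hc_mul1 x : hcong (HMul (HConst 1) x) x
| hc_mulDl x y z : hcong (HMul (HAdd x y) z) (HAdd (HMul x z) (HMul y z))
| hc_mulDr x y z : hcong (HMul x (HAdd y z)) (HAdd (HMul x y) (HMul x z))
| hc_constD a b : hcong (HConst (a + b)) (HAdd (HConst a) (HConst b))
| hc_constM a b : hcong (HConst (a * b)) (HMul (HConst a) (HConst b))
| hc_constC a x : hcong (HMul (HConst a) x) (HMul x (HConst a))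
| hc_idem i : hcong (HMul (HGen i) (HGen i)) (HGen i)
| hc_braid (i j : 'I_n.-1) : j = i.+1 :> nat ->
    hcong (HMul (HGen i) (HMul (HGen j) (HGen i)))
          (HMul (HGen j) (HMul (HGen i) (HGen j)))
| hc_comm (i j : 'I_n.-1) : (i.+1 < j)%N || (j.+1 < i)%N ->
    hcong (HMul (HGen i) (HGen j)) (HMul (HGen j) (HGen i)).

HB.instance Definition _ := gen_eqMixin hexpr.
HB.instance Definition _ := gen_choiceMixin hexpr.

Definition hcongb (x y : hexpr) : bool := `[< hcong x y >].

Fact hcongb_equiv : equiv_class_of hcongb.
Proof.
split=> [x|x y|y x z].
- exact/asboolP/hc_refl.
- by apply/asboolP/asboolP => /hc_sym.
- by move=> /asboolP xy /asboolP yz; apply/asboolP/(hc_trans xy yz).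
Qed.

Canonical hcongb_equivRel := EquivRelPack hcongb_equiv.
Canonical hcongb_encModRel := defaultEncModRel hcongb.

Definition hecke0 := {eq_quot hcongb}.
HB.instance Definition _ := Choice.on hecke0.
HB.instance Definition _ := EqQuotient.on hecke0.

Definition hconst (a : K) : hecke0 := \pi_hecke0 (HConst a).
Definition hpi (i : 'I_n.-1) : hecke0 := \pi_hecke0 (HGen i).
Definition hadd (x y : hecke0) : hecke0 := \pi_hecke0 (HAdd (repr x) (repr y)).
Definition hmul (x y : hecke0) : hecke0 := \pi_hecke0 (HMul (repr x) (repr y)).

Lemma hcongP x y : hcong x y <-> \pi_hecke0 x = \pi_hecke0 y.
Proof.
by split=> [h|/eqmodP/asboolP //]; apply/eqmodP/asboolP.
Qed.

Lemma hcong_repr x : hcong (repr (\pi_hecke0 x)) x.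
Proof. by apply/hcongP; rewrite reprK. Qed.

Lemma haddE x y : hadd (\pi x) (\pi y) = \pi_hecke0 (HAdd x y).
Proof. by apply/hcongP/hc_add; apply: hcong_repr. Qed.
Lemma hmulE x y : hmul (\pi x) (\pi y) = \pi_hecke0 (HMul x y).
Proof. by apply/hcongP/hc_mul; apply: hcong_repr. Qed.

Fact haddA : associative hadd.
Proof.
move=> x y z; rewrite -[x]reprK -[y]reprK -[z]reprK !haddE.
exact/hcongP/hc_addA.
Qed.
Fact haddC : commutative hadd.
Proof.
by move=> x y; rewrite -[x]reprK -[y]reprK !haddE; apply/hcongP/hc_addC.
Qed.
Fact hadd0 : left_id (hconst 0) hadd.
Proof. by move=> x; rewrite -[x]reprK haddE; apply/hcongP/hc_add0. Qed.
Fact hmulA : associative hmul.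
Proof.
move=> x y z; rewrite -[x]reprK -[y]reprK -[z]reprK !hmulE.
exact/hcongP/hc_mulA.
Qed.
Fact hmul1 : left_id (hconst 1) hmul.
Proof. by move=> x; rewrite -[x]reprK hmulE; apply/hcongP/hc_mul1. Qed.
Fact hconstC a x : hmul (hconst a) x = hmul x (hconst a).
Proof. by rewrite -[x]reprK !hmulE; apply/hcongP/hc_constC. Qed.
Fact hmulr1 : right_id (hconst 1) hmul.
Proof. by move=> x; rewrite -hconstC hmul1. Qed.
Fact hmulDl : left_distributive hmul hadd.
Proof.
move=> x y z; rewrite -[x]reprK -[y]reprK -[z]reprK !(haddE, hmulE).
exact/hcongP/hc_mulDl.
Qed.
Fact hmulDr : right_distributive hmul hadd.
Proof.
move=> x y z; rewrite -[x]reprK -[y]reprK -[z]reprK !(haddE, hmulE).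
exact/hcongP/hc_mulDr.
Qed.
Fact hconstD a b : hconst (a + b) = hadd (hconst a) (hconst b).
Proof. by rewrite haddE; apply/hcongP/hc_constD. Qed.
Fact hconstM a b : hconst (a * b) = hmul (hconst a) (hconst b).
Proof. by rewrite hmulE; apply/hcongP/hc_constM. Qed.

Definition hopp (x : hecke0) : hecke0 := hmul (hconst (-1)) x.
Fact haddN : left_inverse (hconst 0) hopp hadd.
Proof.
by move=> x; rewrite -[x]reprK /hopp hmulE haddE; apply/hcongP/hc_addN.
Qed.

HB.instance Definition _ :=
  GRing.isZmodule.Build hecke0 haddA haddC hadd0 haddN.
HB.instance Definition _ :=
  GRing.Zmodule_isPzRing.Build hecke0 hmulA hmul1 hmulr1 hmulDl hmulDr.

Section Evaluation.
Variables (V : lmodType K) (op : 'I_n.-1 -> V -> V).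

Fixpoint heval (x : hexpr) (v : V) : V :=
  match x with
  | HConst a => a *: v
  | HGen i => op i v
  | HAdd x y => heval x v + heval y v
  | HMul x y => heval x (heval y v)
  end.

Hypothesis op_linear : forall i a u v, op i (a *: u + v) = a *: op i u + op i v.

Lemma heval_linear x a u v : heval x (a *: u + v) = a *: heval x u + heval x v.
Proof.
elim: x u v => [b|i|x IHx y IHy|x IHx y IHy] u v /=.
- by rewrite scalerDr !scalerA mulrC.
- exact: op_linear.
- by rewrite IHx IHy scalerDr addrACA.
- by rewrite IHy IHx.
Qed.

Lemma hevalD x u v : heval x (u + v) = heval x u + heval x v.
Proof. by have := heval_linear x 1 u v; rewrite !scale1r. Qed.

Lemma hevalZ x a u : heval x (a *: u) = a *: heval x u.
Proof.
have h0 : heval x 0 = 0.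
  by apply: (addrI (heval x 0)); rewrite -hevalD !addr0.
by have := heval_linear x a u 0; rewrite !addr0 h0 addr0.
Qed.

Hypothesis op_idem : forall i v, op i (op i v) = op i v.
Hypothesis op_braid : forall (i j : 'I_n.-1) v, j = i.+1 :> nat ->
  op i (op j (op i v)) = op j (op i (op j v)).
Hypothesis op_comm : forall (i j : 'I_n.-1) v,
  (i.+1 < j)%N || (j.+1 < i)%N -> op i (op j v) = op j (op i v).

Lemma heval_hcong x y : hcong x y -> heval x =1 heval y.
Proof.
elim=> {x y}.
- by [].
- by move=> x y _ IH v; rewrite IH.
- by move=> x y z _ IH1 _ IH2 v; rewrite IH1.
- by move=> x x' y y' _ IH1 _ IH2 v /=; rewrite IH1 IH2.
- by move=> x x' y y' _ IH1 _ IH2 v /=; rewrite IH2 IH1.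
- by move=> x y z v /=; rewrite addrA.
- by move=> x y v /=; rewrite addrC.
- by move=> x v /=; rewrite scale0r add0r.
- by move=> x v /=; rewrite scaleN1r addNr scale0r.
- by [].
- by move=> x v /=; rewrite scale1r.
- by [].
- by move=> x y z v /=; rewrite hevalD.
- by move=> a b v /=; rewrite scalerDl.
- by move=> a b v /=; rewrite scalerA.
- by move=> a x v /=; rewrite hevalZ.
- by move=> i v /=; rewrite op_idem.
- by move=> i j ij v /=; apply: op_braid.
- by move=> i j ij v /=; apply: op_comm.
Qed.

End Evaluation.

Fact hecke0_nonzero : 1 != 0 :> hecke0.
Proof.
apply/eqP => /hcongP /(@heval_hcong K^o (fun=> id)) => /(_ _ _ _ _ 1).
by rewrite /= scale1r scale0r => h; have /eqP := oner_neq0 K; case; apply: h.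
Qed.
HB.instance Definition _ :=
  GRing.PzSemiRing_isNonZero.Build hecke0 hecke0_nonzero.

Definition hscale (a : K) (x : hecke0) : hecke0 := hconst a * x.

Fact hscaleA a b x : hscale a (hscale b x) = hscale (a * b) x.
Proof. by rewrite /hscale mulrA hconstM. Qed.
Fact hscale1 : left_id 1 hscale.
Proof. exact: mul1r. Qed.
Fact hscaleDr : right_distributive hscale +%R.
Proof. by move=> a; apply: mulrDr. Qed.
Fact hscaleDl x : {morph hscale^~ x : a b / a + b}.
Proof. by move=> a b; rewrite /hscale hconstD; apply: mulrDl. Qed.
HB.instance Definition _ := GRing.Zmodule_isLmodule.Build K hecke0
  hscaleA hscale1 hscaleDr hscaleDl.

Fact hscaleAl (a : K) (x y : hecke0) : a *: (x * y) = (a *: x) * y.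
Proof. exact: mulrA. Qed.
HB.instance Definition _ := GRing.Lmodule_isLalgebra.Build K hecke0 hscaleAl.
Fact hscaleAr (a : K) (x y : hecke0) : a *: (x * y) = x * (a *: y).
Proof.
by rewrite /GRing.scale /= /hscale mulrA [_ * x]hconstC -mulrA.
Qed.
HB.instance Definition _ := GRing.Lalgebra_isAlgebra.Build K hecke0 hscaleAr.

End Hecke0.

Arguments hpi K {n} i.

Definition is_composition (n : nat) (alpha : seq nat) : bool :=
  all (ltn 0) alpha && (sumn alpha == n).

Section Words.
Variables (n : nat) (alpha : seq nat).

(* Letters [1, ..., m] are indexed from 0 by ['I_(size alpha)]. *)
Definition word := {w : n.-tuple 'I_(size alpha) |
  [forall j : 'I_(size alpha), count_mem j w == nth 0%N alpha j]}.

Fact pos_r_proof (i : 'I_n.-1) : (i.+1 < n)%N.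
Proof. by case: i => i /=; lia. Qed.

Definition pos_l (i : 'I_n.-1) : 'I_n := widen_ord (leq_pred n) i.
Definition pos_r (i : 'I_n.-1) : 'I_n := Ordinal (pos_r_proof i).

Definition swap_at T (i : 'I_n.-1) (w : n.-tuple T) : n.-tuple T :=
  [tuple tnth w (tperm (pos_l i) (pos_r i) p) | p < n].

Definition tuple_step (i : 'I_n.-1) (w : n.-tuple 'I_(size alpha)) :=
  if (tnth w (pos_r i) <= tnth w (pos_l i))%N then w else swap_at i w.

Fact tuple_step_proof i (w : word) :
  [forall j, count_mem j (tuple_step i (val w)) == nth 0%N alpha j].
Proof.
rewrite /tuple_step; case: ifP => _; first exact: valP w.
have /seq.permP pe : perm_eq (swap_at i (val w)) (val w).
  by apply/tuple_permP; exists (tperm (pos_l i) (pos_r i)).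
have /forallP cw := valP w; apply/forallP => j.
by have := pe (pred1 j); rewrite (eqP (cw j)) => ->.
Qed.

Definition word_step i (w : word) : word := 
  exist _ (tuple_step i (val w)) (tuple_step_proof i w).

(* Every letter occurs in a word of content a composition [alpha], so that
   [index] is the position of its first occurrence. *)
Definition Yword (w : word) : bool :=
  [forall j : 'I_(size alpha), forall k : 'I_(size alpha),
    (k == j.+1 :> nat) ==> (index j (val w) < index k (val w))%N].

Definition vfun (w : word) (p : nat) : nat := nth 0%N [seq val x | x <- val w] p.

Lemma vfunE w (p : 'I_n) : vfun w p = tnth (val w) p.
Proof.
rewrite /vfun (nth_map (tnth (val w) p)) ?size_tuple //.
by rewrite -tnth_nth.
Qed.

Lemma vfun_inj u w : (forall p, (p < n)%N -> vfun u p = vfun w p) -> u = w.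
Proof.
move=> h; apply/val_inj/eq_from_tnth => p; apply/val_inj.
by rewrite /= -!vfunE h.
Qed.

Definition fstep i (f : nat -> nat) p :=
  if p == i then maxn (f i) (f i.+1)
  else if p == i.+1 then minn (f i) (f i.+1) else f p.

Lemma vfun_step (i : 'I_n.-1) w p : (p < n)%N ->
  vfun (word_step i w) p = fstep i (vfun w) p.
Proof.
move=> pn; rewrite (vfunE _ (Ordinal pn)) /= /tuple_step /fstep.
have el : vfun w i = tnth (val w) (pos_l i) by rewrite -vfunE.
have er : vfun w i.+1 = tnth (val w) (pos_r i) by rewrite -vfunE.
rewrite /= in el er; rewrite el er; case: ifP => h; last rewrite tnth_mktuple.
  case: eqP => [pi|_].
    have -> : Ordinal pn = pos_l i by apply: val_inj.
    lia.
  case: eqP => [pi|_]; last by rewrite -vfunE.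
  have -> : Ordinal pn = pos_r i by apply: val_inj.
  lia.
case: eqP => [pi|npi].
  have -> : Ordinal pn = pos_l i by apply: val_inj.
  rewrite tpermL; lia.
case: eqP => [pi|npi'].
  have -> : Ordinal pn = pos_r i by apply: val_inj.
  rewrite tpermR; lia.
rewrite tpermD -?vfunE //; apply/eqP => /(congr1 val) /= e; lia.
Qed.

Lemma eq_fstep i f g p : (i.+1 < n)%N -> (p < n)%N ->
  (forall q, (q < n)%N -> f q = g q) -> fstep i f p = fstep i g p.
Proof. by move=> hi pn fg; rewrite /fstep !fg // ltnW. Qed.

Lemma word_step_idem i w : word_step i (word_step i w) = word_step i w.
Proof.
apply: vfun_inj => p pn; rewrite !vfun_step //.
rewrite (eq_fstep (pos_r_proof i) pn (@vfun_step i w)) /fstep.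
by do ![case: eqP => ? //=]; lia.
Qed.

Lemma word_step_comm (i j : 'I_n.-1) w : (i.+1 < j)%N || (j.+1 < i)%N ->
  word_step i (word_step j w) = word_step j (word_step i w).
Proof.
move=> ij; apply: vfun_inj => p pn; rewrite !vfun_step //.
rewrite (eq_fstep (pos_r_proof i) pn (@vfun_step j w)).
rewrite (eq_fstep (pos_r_proof j) pn (@vfun_step i w)) /fstep.
by do ![case: eqP => ? //=]; lia.
Qed.

Lemma word_step_braid (i j : 'I_n.-1) w : j = i.+1 :> nat ->
  word_step i (word_step j (word_step i w)) =
  word_step j (word_step i (word_step j w)).
Proof.
move=> ij; have hi := pos_r_proof i; have hj := pos_r_proof j.
have E (a b c : 'I_n.-1) q : (q < n)%N ->
    vfun (word_step a (word_step b (word_step c w))) q =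
    fstep a (fstep b (fstep c (vfun w))) q.
  move=> qn; rewrite vfun_step //; apply: (eq_fstep (pos_r_proof a) qn).
  move=> q' q'n; rewrite vfun_step //.
  by apply: (eq_fstep (pos_r_proof b) q'n) => ? ?; apply: vfun_step.
apply: vfun_inj => p pn; rewrite !E // ij /fstep !eqxx.
have n1 : (i.+1 == i) = false by lia.
have n2 : (i.+2 == i) = false by lia.
have n3 : (i.+2 == i.+1) = false by lia.
have n4 : (i == i.+1 :> nat) = false by lia.
have n5 : (i == i.+2 :> nat) = false by lia.
have n6 : (i.+1 == i.+2) = false by lia.
rewrite !(n1, n2, n3, n4, n5, n6).
case: (@eqP _ p i) => [e|?]; rewrite ?e ?(n4, n5); first by lia.
case: (@eqP _ p i.+1) => [e|?]; rewrite ?e ?(n6, eqxx); first by lia.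
by case: (@eqP _ p i.+2) => [e|?]; rewrite ?e; lia.
Qed.

Lemma index_ltP (w : word) (j k : 'I_(size alpha)) :
  j != k ->
  reflect (exists2 p : 'I_n, tnth (val w) p = j &
            forall q : 'I_n, (q < p)%N -> tnth (val w) q <> k)
          (index j (val w) < index k (val w))%N.
Proof.
move=> jk; apply: (iffP idP) => [h|[p pj pk]].
  have jn : (index j (val w) < n)%N.
    apply: leq_trans h _.
    by rewrite -[X in (_ <= X)%N](size_tuple (val w)) index_size.
  exists (Ordinal jn) => [|q qp qk].
    by rewrite (tnth_nth j) nth_index // -index_mem size_tuple.
  have := @before_find _ k (pred1 k) (val w) q.
  rewrite -/(index k _) => /(_ (ltn_trans qp h)) /=.
  by rewrite -tnth_nth qk eqxx.
have jw : (index j (val w) <= p)%N.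
  rewrite leqNgt; apply/negP => /(@before_find _ j (pred1 j) (val w) p) /=.
  by rewrite -tnth_nth pj eqxx.
apply: leq_ltn_trans jw _; rewrite ltnNge; apply/negP => kp.
have kn : (index k (val w) < n)%N by apply: leq_ltn_trans kp _.
have kk : tnth (val w) (Ordinal kn) = k.
  by rewrite (tnth_nth k) nth_index // -index_mem size_tuple.
case: (ltngtP (index k (val w)) p) kp => // [kp _|e _].
  exact: (pk (Ordinal kn)).
by case/eqP: jk; rewrite -kk -pj; congr tnth; apply: val_inj.
Qed.

Lemma Yword_step i w : Yword (word_step i w) -> Yword w.
Proof.
move=> /forallP Y; apply/forallP => j; apply/forallP => k.
apply/implyP => /eqP kj; have /forallP /(_ k) := Y j.
have jk : j != k by apply/eqP => e; move: kj; rewrite e; lia.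
rewrite kj eqxx implyTb => /(index_ltP _ jk) [p pj pk].
apply/(index_ltP _ jk).
have tval_step (q : 'I_n) : tnth (val (word_step i w)) q =
    fstep i (vfun w) q :> nat by rewrite -vfunE vfun_step.
have qk (q : 'I_n) : (q < p)%N -> fstep i (vfun w) q <> j.+1.
  by move=> qp e; apply: (pk q qp); apply/val_inj; rewrite /= tval_step e kj.
have {}pj : fstep i (vfun w) p = j by rewrite -tval_step pj.
suff [p' [p'n p'j p'k]] : exists p', [/\ (p' < n)%N, vfun w p' = j &
    forall q, (q < p')%N -> vfun w q <> j.+1].
  exists (Ordinal p'n) => [|q qp e]; first by apply/val_inj; rewrite /= -vfunE.
  by apply: (p'k q qp); rewrite vfunE e kj.
have qk' q : (q < p)%N -> fstep i (vfun w) q <> j.+1.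
  by move=> qp; apply: (qk (Ordinal (ltn_trans qp (ltn_ord p)))).
have hi := pos_r_proof i; have hp := ltn_ord p.
case: (eqVneq (p : nat) i) => [pi|npi].
  move: pj; rewrite /fstep pi eqxx => pj.
  have lt_i q : (q < i)%N -> vfun w q <> j.+1.
    move=> qi; have := qk' q; rewrite pi => /(_ qi); rewrite /fstep.
    by case: eqP => [|_]; [lia|case: eqP; [lia|]].
  case: (leqP (vfun w i.+1) (vfun w i)) => h.
    exists i; split; [lia|lia|exact: lt_i].
  exists i.+1; split; [lia|lia|move=> q; rewrite ltnS leq_eqVlt].
  by case/orP => [/eqP ->|]; [lia|exact: lt_i].
case: (eqVneq (p : nat) i.+1) => [pi|npi1].
  move: pj; rewrite /fstep pi eqxx; have -> : (i.+1 == i) = false by lia.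
  move=> pj.
  have lt_i q : (q < i)%N -> vfun w q <> j.+1.
    move=> qi; have := qk' q; rewrite pi => /(_ (ltnW qi)); rewrite /fstep.
    by case: eqP => [|_]; [lia|case: eqP; [lia|]].
  have := qk' i; rewrite pi /fstep eqxx => /(_ (ltnSn _)) hmax.
  case: (leqP (vfun w i.+1) (vfun w i)) => h.
    exists i.+1; split; [lia|lia|move=> q; rewrite ltnS leq_eqVlt].
    by case/orP => [/eqP ->|]; [lia|exact: lt_i].
  exists i; split; [lia|lia|exact: lt_i].
exists p; split => // [|q qp].
  by rewrite -pj /fstep (negPf npi) (negPf npi1).
have := qk' q qp; rewrite /fstep.
case: (eqVneq q i) => [qi|_].
  have := qk' i.+1; rewrite /fstep eqxx; have -> : (i.+1 == i) = false by lia.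
  rewrite qi; lia.
case: (eqVneq q i.+1) => [qi|//].
have := qk' i; rewrite /fstep eqxx qi; lia.
Qed.

End Words.

Section Modules.
Variables (K : fieldType) (n : nat) (alpha : seq nat).
Notation word := (word n alpha).

Definition wvect := {ffun word -> K^o}.
HB.instance Definition _ := Vector.on wvect.

Definition basis_word (w : word) : wvect := [ffun u => (u == w)%:R].

Definition lin_ext (f : word -> word) (v : wvect) : wvect :=
  \sum_w v w *: basis_word (f w).

Lemma lin_ext_linear f a u v :
  lin_ext f (a *: u + v) = a *: lin_ext f u + lin_ext f v.
Proof.
rewrite /lin_ext scaler_sumr -big_split /=; apply: eq_bigr => w _.
by rewrite !ffunE scalerDl scalerA.
Qed.
HB.instance Definition _ f :=
  GRing.isLinear.Build K wvect wvect _ (lin_ext f) (lin_ext_linear f).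

Lemma lin_ext_word f w : lin_ext f (basis_word w) = basis_word (f w).
Proof.
rewrite /lin_ext (bigD1 w) //= ffunE eqxx scale1r big1 ?addr0 // => u uw.
by rewrite ffunE (negPf uw) scale0r.
Qed.

Lemma lin_ext_comp f g v : lin_ext f (lin_ext g v) = lin_ext (f \o g) v.
Proof.
rewrite [lin_ext g v]/lin_ext linear_sum; apply: eq_bigr => w _.
by rewrite linearZ /= lin_ext_word.
Qed.

Lemma eq_lin_ext f g : f =1 g -> lin_ext f =1 lin_ext g.
Proof. by move=> fg v; apply: eq_bigr => w _; rewrite fg. Qed.

Definition pi_op (i : 'I_n.-1) : wvect -> wvect := lin_ext (word_step i).

Fact pi_op_linear i a u v : pi_op i (a *: u + v) = a *: pi_op i u + pi_op i v.
Proof. exact: lin_ext_linear. Qed.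
Fact pi_op_idem i v : pi_op i (pi_op i v) = pi_op i v.
Proof.
by rewrite /pi_op lin_ext_comp; apply: eq_lin_ext => w; apply: word_step_idem.
Qed.
Fact pi_op_braid (i j : 'I_n.-1) v : j = i.+1 :> nat ->
  pi_op i (pi_op j (pi_op i v)) = pi_op j (pi_op i (pi_op j v)).
Proof.
move=> ij; rewrite /pi_op !lin_ext_comp.
by apply: eq_lin_ext => w; apply: word_step_braid.
Qed.
Fact pi_op_comm (i j : 'I_n.-1) v : (i.+1 < j)%N || (j.+1 < i)%N ->
  pi_op i (pi_op j v) = pi_op j (pi_op i v).
Proof.
move=> ij; rewrite /pi_op !lin_ext_comp.
by apply: eq_lin_ext => w; apply: word_step_comm.
Qed.

(* Same carrier as [wvect], under another name: scalars of [wvect] are in [K],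
   those of [Malpha] in [hecke0 K n]. *)
Definition Malpha := wvect.
HB.instance Definition _ := GRing.Zmodule.on Malpha.

Definition Malpha_scale (h : hecke0 K n) (v : Malpha) : Malpha :=
  heval (V := wvect) pi_op (repr h) v.

Lemma Malpha_scaleE x (v : Malpha) :
  Malpha_scale (\pi x) v = heval (V := wvect) pi_op x v.
Proof.
apply: (@heval_hcong K n wvect pi_op pi_op_linear pi_op_idem pi_op_braid
  pi_op_comm).
exact: hcong_repr.
Qed.

Fact Malpha_scaleA a b v :
  Malpha_scale a (Malpha_scale b v) = Malpha_scale (a * b) v.
Proof. by rewrite [RHS]Malpha_scaleE. Qed.
Fact Malpha_scale1 : left_id 1 Malpha_scale.
Proof. by move=> v; rewrite [LHS]Malpha_scaleE /= scale1r. Qed.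
Fact Malpha_scaleDr : right_distributive Malpha_scale +%R.
Proof. by move=> a u v; apply: hevalD pi_op_linear _ _ _. Qed.
Fact Malpha_scaleDl v : {morph Malpha_scale^~ v : a b / a + b}.
Proof. by move=> a b; rewrite [LHS]Malpha_scaleE. Qed.

HB.instance Definition _ := GRing.Zmodule_isLmodule.Build (hecke0 K n) Malpha
  Malpha_scaleA Malpha_scale1 Malpha_scaleDr Malpha_scaleDl.

Lemma hpi_word i w :
  hpi K i *: (basis_word w : Malpha) = basis_word (word_step i w).
Proof. by rewrite [LHS]Malpha_scaleE /= [LHS]lin_ext_word. Qed.

Lemma hconst_scale a (v : wvect) : hconst n a *: (v : Malpha) = a *: v.
Proof. exact: Malpha_scaleE. Qed.

Definition Nalpha_pred : {pred Malpha} := fun v =>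
  (v : wvect) \in <<[seq basis_word w | w <- enum [pred w | ~~ Yword w]]>>%VS.

Lemma Nalpha_predP (v : Malpha) :
  reflect (forall w, Yword w -> (v : wvect) w = 0) (v \in Nalpha_pred).
Proof.
apply: (iffP idP) => [|v0].
  pose X := in_tuple [seq basis_word u | u <- enum [pred u | ~~ Yword u]].
  move=> /(@coord_span _ wvect _ X (v : wvect)) vE w Yw; rewrite vE.
  rewrite sum_ffunE big1 // => i _; rewrite ffunE.
  have /mapP [u] : X`_i \in X by rewrite mem_nth // size_tuple.
  rewrite mem_enum inE => Yu ->; rewrite ffunE.
  by case: eqP Yw Yu => [-> ->|_ _ _] //; rewrite scaler0.
have -> : v = \sum_(w | ~~ Yword w) (v : wvect) w *: basis_word w.
  apply/ffunP => u; rewrite sum_ffunE; case: (boolP (Yword u)) => Yu.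
    rewrite v0 // big1 // => w Yw; rewrite !ffunE.
    by case: eqP Yw Yu => [-> /negP|_ _ _] //; rewrite scaler0.
  rewrite (bigD1 u) //= !ffunE eqxx big1 ?addr0 => [|w /andP[_ wu]].
    by rewrite /GRing.scale /= mulr1.
  by rewrite !ffunE eq_sym (negPf wu) scaler0.
apply: memv_suml => w Yw; apply/memvZ/memv_span/map_f.
by rewrite mem_enum.
Qed.

Fact Nalpha_closed : submod_closed Nalpha_pred.
Proof.
have hevalN x (v : wvect) : (v : Malpha) \in Nalpha_pred ->
    (heval pi_op x v : Malpha) \in Nalpha_pred.
  elim: x v => [a|i|x IHx y IHy|x IHx y IHy] v Nv /=.
  - exact: memvZ.
  - apply/Nalpha_predP => w Yw; rewrite sum_ffunE big1 // => u _; rewrite !ffunE.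
    case: eqP Yw => [-> /Yword_step Yu|_ _]; last by rewrite scaler0.
    by rewrite (elimT (Nalpha_predP v) Nv _ Yu) scale0r.
  - by apply: memvD; [apply: IHx|apply: IHy].
  - exact/IHx/IHy.
split=> [|h u v Nu Nv]; first exact: mem0v.
by apply: memvD => //; apply: hevalN.
Qed.

Definition Nalpha : submodule Malpha := Submodule Nalpha_closed.

Definition Valpha := quotmod Nalpha.
HB.instance Definition _ := GRing.Lmodule.on Valpha.

End Modules.

(* Main.v *)
(* The weakly increasing word w0 generates V_alpha, since any other word has a
   descent, and undoing it gives a word that some pi_i maps back. Every pi_i
   acting inside a block of equal letters of w0 fixes w0; a vector fixed by all
   these pi_i is supported on Y-words that are weakly decreasing along each such
   block, and the only such Y-word is w0. As these operators fix the components
   of w0 in a direct sum decomposition, one of the components is 0 and the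
   other one generates V_alpha. *)

Require Import Defs.
From mathcomp Require Import all_boot all_algebra.
From mathcomp Require Import perm zify.

Set Implicit Arguments.
Unset Strict Implicit.
Unset Printing Implicit Defensive.

Import GRing.Theory.
Local Open Scope ring_scope.
Local Open Scope quotient_scope.

(** * Words compared with a sorted word of the same content *)

Definition leo m : rel 'I_m := relpre val leq.
Arguments leo {m}.

Lemma leo_refl m : reflexive (@leo m).
Proof. by move=> x; apply: leqnn. Qed.
Lemma leo_trans m : transitive (@leo m).
Proof. by move=> y x z; apply: leq_trans. Qed.
Lemma leo_anti m : antisymmetric (@leo m).
Proof. by move=> x y /anti_leq /val_inj. Qed.
Lemma leo_total m : total (@leo m).
Proof. by move=> x y; apply: leq_total. Qed.

Lemma index_cat_cons_le (T : eqType) (s t : seq T) x :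
  (index x (s ++ x :: t) <= size s)%N.
Proof.
rewrite index_cat; case: ifP => xs; last by rewrite /= eqxx addn0.
exact: index_size.
Qed.

(* At the first letter where y and v differ, that of y is larger, as v is sorted;
   the letter of v must then occur earlier in y, hence in v, so that it continues
   a block of v, contradicting the last hypothesis. *)
Lemma block_decreasing_eq m (y v : seq 'I_m) :
    perm_eq y v -> sorted leo v ->
    {homo index^~ y : j k / (val j < val k)%N >-> (j < k)%N} ->
    (forall s a b c t t', y = s ++ [:: a, b & t] -> v = s ++ [:: c, c & t'] ->
       leo b a) ->
  y = v.
Proof.
move=> pyv sv Yy blk.
(* Induction on what remains after a common prefix [s]. *)
suff H t s t' : y = s ++ t -> v = s ++ t' -> t = t' by exact: (H y [::] v).
elim: t s t' => [|x t IH] s t' ey ev.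
  by move/perm_size: pyv; rewrite ey ev !size_cat; case: t' {ev} => //= *; lia.
have ptt : perm_eq (x :: t) t' by rewrite -(perm_cat2l s) -ey -ev.
case: t' ptt ev => [|x' t'] ptt ev; first by move/perm_size: ptt.
suff exx : x = x'.
  by rewrite exx in ey *; congr cons; apply: (IH (rcons s x')); rewrite cat_rcons.
have le_x'x : leo x' x.
  have := perm_mem ptt x; rewrite !inE eqxx /= => /esym /orP[/eqP->|xt'].
    exact: leo_refl.
  move: sv; rewrite ev => /(subseq_sorted (@leo_trans m) (suffix_subseq _ _)) /=.
  by move/(order_path_min (@leo_trans m))/allP; apply.
apply: leo_anti; rewrite le_x'x andbT /leo /= leqNgt; apply/negP => lt_x'x.
have x's : x' \in s.
  have := leq_trans (Yy _ _ lt_x'x); rewrite ey.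
  move/(_ _ (index_cat_cons_le _ _ _)); rewrite index_cat; case: ifP => // _.
  by rewrite ltnNge leq_addr.
case/lastP: s => // s a in ey ev x's *.
(* Sortedness of [v] gives [a <= x']; as [x'] lies in the prefix, which ends in [a], it also gives
   [x' <= a]. *)
have ax' : a = x'.
  apply: leo_anti; move: sv.
  rewrite ev cat_rcons => /(subseq_sorted (@leo_trans m)) sub.
  have := sub _ (suffix_subseq _ _) => /= /andP[-> _] /=.
  move: x's; rewrite mem_rcons inE => /orP[/eqP->|x's]; first exact: leo_refl.
  have : subseq [:: x'; a] (s ++ [:: a, x' & t']).
    apply: (@cat_subseq _ [:: x'] [:: a]); first by rewrite sub1seq.
    by rewrite sub1seq inE eqxx.
  by move/sub => /= /andP[].
rewrite ax' in ey ev.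
have := blk s x' x x' t t'; rewrite ey ev !cat_rcons => /(_ erefl erefl).
by rewrite /leo /= leqNgt lt_x'x.
Qed.

(** * The sorted word, descents and fixed Y-words *)

Section SortedWord.
Variables (n : nat) (alpha : seq nat).
Notation word := (word n alpha).

Lemma word_perm (u w : word) : perm_eq (val u) (val w).
Proof.
apply/allP => j _ /=.
by rewrite (eqP (forallP (valP u) j)) (eqP (forallP (valP w) j)).
Qed.

Lemma mem_word (w : word) j : is_composition n alpha -> j \in val (val w).
Proof.
move=> alphaP.
rewrite -has_pred1 has_count (eqP (forallP (valP w) j)).
by case/andP: alphaP => /allP + _; apply; apply: mem_nth.
Qed.

Lemma exists_sorted_word :
  is_composition n alpha -> exists w : word, sorted leo (val w).
Proof.
move=> alphaP.
(* Each letter is repeated as [alpha] prescribes; sorting keeps the content and makes the order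
   immediate. *)
pose s := flatten
    [seq nseq (nth 0%N alpha (j : 'I__)) j | j <- enum 'I_(size alpha)].
have cs j : count_mem j s = nth 0%N alpha j.
  rewrite count_flatten -map_comp -[RHS]addn0.
  rewrite sumnE big_map big_enum /= (bigD1 j) //= count_nseq /= eqxx mul1n.
  rewrite big1 // => k kj; rewrite count_nseq /= (negPf kj); lia.
have ss : size (sort leo s) == n.
  case/andP: alphaP => _ /eqP <-.
  rewrite size_sort size_flatten /shape -map_comp sumnE big_map big_enum /=.
  rewrite sumnE (big_nth 0%N) big_mkord; apply/eqP/eq_bigr => j _.
  by rewrite size_nseq.
have cw : [forall j : 'I_(size alpha),
    count_mem j (Tuple ss) == nth 0%N alpha j].
  by apply/forallP => j /=; rewrite count_sort cs.
exists (exist _ (Tuple ss) cw) => /=.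
exact: (sort_sorted (@leo_total _)).
Qed.

(** Since the parts are positive, every letter occurs and [index] gives true positions; a sorted
    word cannot have [j+1] before [j]. *)
Lemma sorted_word_Yword (w : word) :
  is_composition n alpha -> sorted leo (val w) -> Yword w.
Proof.
move=> alphaP sw; apply/forallP => j; apply/forallP => k; apply/implyP => /eqP kj.
rewrite ltnNge; apply/negP => /(sorted_leq_index (@leo_trans _) (@leo_refl _) sw).
move/(_ (mem_word w k alphaP) (mem_word w j alphaP)); rewrite /leo /=; lia.
Qed.

(** [Yword] compares consecutive letters only; induction on the larger letter chains these
    comparisons. *)
Lemma Yword_index_homo (w : word) : Yword w ->
  {homo index^~ (val w) : j k / (val j < val k)%N >-> (j < k)%N}.
Proof.
move=> /forallP Y j k; move: {-1}(val k) (erefl (val k)) => l.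
elim: l k => // l IH k kl; rewrite ltnS leq_eqVlt => jl.
have lm : (l < size alpha)%N by rewrite -ltnS -kl; apply: ltnW; exact: ltn_ord.
have := forallP (Y (Ordinal lm)) k; rewrite kl eqxx /= => lk.
case/orP: jl => [/eqP jl|jl].
  by have -> : j = Ordinal lm by apply: val_inj.
exact: ltn_trans (IH (Ordinal lm) erefl jl) lk.
Qed.

Fact swap_content i (w : word) :
  [forall j, count_mem j (swap_at i (val w)) == nth 0%N alpha j].
Proof.
have /seq.permP pe : perm_eq (swap_at i (val w)) (val w).
  by apply/tuple_permP; exists (tperm (pos_l i) (pos_r i)).
apply/forallP => j.
by have := pe (pred1 j); rewrite (eqP (forallP (valP w) j)) => ->.
Qed.

Definition word_swap i (w : word) : word := 
  exist _ (swap_at i (val w)) (swap_content i w).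

(** The swap turns the descent into an ascent, which [word_step] swaps back. *)
Lemma word_step_swap i (w : word) :
  (tnth (val w) (pos_r i) < tnth (val w) (pos_l i))%N ->
  word_step i (word_swap i w) = w.
Proof.
move=> lt_w; apply/val_inj; rewrite /= /tuple_step !tnth_mktuple tpermL tpermR.
rewrite leqNgt lt_w; apply/eq_from_tnth => p.
by rewrite !tnth_mktuple tpermK.
Qed.

Definition word_weight (w : word) := (\sum_(p < n) p * tnth (val w) p)%N.

(** Only two terms change: for letters [a > b] at [i] and [i+1], the weight grows by [a - b]. *)
Lemma word_weight_swap i (w : word) :
  (tnth (val w) (pos_r i) < tnth (val w) (pos_l i))%N ->
  (word_weight w < word_weight (word_swap i w))%N.
Proof.
move=> lt_w.
have lr : pos_r i != pos_l i by rewrite -val_eqE /=; lia.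
have split_weight (u : word) : (word_weight u =
    i * tnth (val u) (pos_l i) + i.+1 * tnth (val u) (pos_r i) +
    \sum_(p < n | (p != pos_l i) && (p != pos_r i)) p * tnth (val u) p)%N.
  by rewrite /word_weight (bigD1 (pos_l i)) // (bigD1 (pos_r i)) //= addnA.
rewrite !split_weight !tnth_mktuple tpermL tpermR.
rewrite [X in (_ < _ + X)%N](_ : _ =
  \sum_(p < n | (p != pos_l i) && (p != pos_r i)) p * tnth (val w) p)%N.
  by rewrite ltn_add2r; nia.
by apply: eq_bigr => p /andP[pl pr]; rewrite tnth_mktuple tpermD // eq_sym.
Qed.

Lemma word_descentP (w : word) :
  sorted leo (val w) \/
  exists i, (tnth (val w) (pos_r i) < tnth (val w) (pos_l i))%N.
Proof.
case: (boolP [exists i, (tnth (val w) (pos_r i) < tnth (val w) (pos_l i))%N]).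
  by move=> /existsP; right.
rewrite negb_exists => /forallP asc; left.
case e: n w asc => [|n'] w asc; first by rewrite (tuple0 (val w)).
have x0 := tnth (val w) ord0.
apply/(sortedP x0) => p; rewrite size_tuple ltnS => pn.
have := asc (Ordinal pn); rewrite -leqNgt !(tnth_nth x0); exact.
Qed.

(* Undoing a descent increases [word_weight], so the process stops. *)
Lemma word_ind_sorted (w0 : word) (P : word -> Prop) :
    sorted leo (val w0) -> P w0 ->
    (forall i w, P w -> P (word_step i w)) ->
  forall w, P w.
Proof.
move=> s0 P0 Pstep.
(* There are finitely many words, so weights are bounded and [N - word_weight w] can serve as
   induction measure. *)
have [N le_N] : exists N, forall w, (word_weight w <= N)%N.
  by exists (\max_w word_weight w)%N => w; apply: leq_bigmax.
move=> w; have [k] := ubnP (N - word_weight w).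
elim: k w => // k IH w ltk.
have [sw|[i lt_i]] := word_descentP w.
  suff -> : w = w0 by [].
  apply/val_inj/val_inj.
  exact: (sorted_eq (@leo_trans _) (@leo_anti _) sw s0 (word_perm w w0)).
rewrite -(word_step_swap lt_i); apply/Pstep/IH.
have := word_weight_swap lt_i; have := le_N (word_swap i w); lia.
Qed.

(** Where [w0] repeats a letter, [word_step] fixes [w0], hence [y], so [y] has no ascent there: this
    is the block condition of [block_decreasing_eq]. *)
Lemma fixed_Yword_sorted (w0 y : word) :
    sorted leo (val w0) -> Yword y ->
    (forall i, word_step i w0 = w0 -> word_step i y = y) ->
  y = w0.
Proof.
move=> s0 Yy fix_y; apply/val_inj/val_inj.
apply: (block_decreasing_eq (word_perm y w0) s0 (Yword_index_homo Yy)).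
move=> s a b c t t' ey e0.
have sn : (size s < n.-1)%N.
  by move/(congr1 size): (ey); rewrite size_tuple size_cat /=; lia.
(* Counting from 0, the two letters after [s] sit at positions [size s] and [size s + 1], where the
   generator of index [size s] acts. *)
pose i := Ordinal sn.
have nthl (w : word) d e r : val (val w) = s ++ [:: d, e & r] ->
    tnth (val w) (pos_l i) = d.
  by move=> ew; rewrite (tnth_nth d) ew nth_cat /= ltnn subnn.
have nthr (w : word) d e r : val (val w) = s ++ [:: d, e & r] ->
    tnth (val w) (pos_r i) = e.
  by move=> ew; rewrite (tnth_nth d) ew nth_cat /= ltnNge leqnSn subSnn.
have /fix_y : word_step i w0 = w0.
  by apply/val_inj; rewrite /= /tuple_step (nthl _ _ _ _ e0) (nthr _ _ _ _ e0) leqnn.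
move/(congr1 (fun w : word => tnth (val w) (pos_l i))).
rewrite /= /tuple_step (nthl _ _ _ _ ey) (nthr _ _ _ _ ey) /leo /=.
case: leqP => // lt_ab; rewrite tnth_mktuple tpermL (nthr _ _ _ _ ey) => ba.
by rewrite ba ltnn in lt_ab.
Qed.

End SortedWord.

(** * Coordinates and generation in the quotient module *)

Section Valpha.
Variables (K : fieldType) (n : nat) (alpha : seq nat).
Notation word := (word n alpha).
Notation M := (Malpha K n alpha).
Notation V := (Valpha K n alpha).

Definition projV (x : M) : V := \pi_(quotmod (Nalpha K n alpha)) x.

(** Coordinates live in [wvect], with scalars in [K], while the Hecke action lives on [M]; [coefM]
    and [wordM] pass between the two. *)
Definition coefM (x : M) (w : word) : K := (x : wvect K n alpha) w.

Definition wordM (w : word) : M := basis_word K w.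

Lemma projV_eqP (x y : M) :
  projV x = projV y <-> forall w, Yword w -> coefM x w = coefM y w.
Proof.
have -> : projV x = projV y <-> x - y \in @Nalpha_pred K n alpha.
  split=> [/eqP|xy]; first by rewrite /projV -Quotient.idealrBE.
  by apply/eqP; rewrite /projV -Quotient.idealrBE.
split=> [/Nalpha_predP N w /N|E].
  by rewrite !ffunE => /eqP; rewrite subr_eq0 => /eqP.
by apply/Nalpha_predP => w /E; rewrite /coefM !ffunE => ->; rewrite subrr.
Qed.

Lemma projVZ h x : h *: projV x = projV (h *: x).
Proof. exact: pi_scale. Qed.

Lemma projVD x y : projV (x + y) = projV x + projV y.
Proof. exact: (raddfD \pi_(quotmod (Nalpha K n alpha))). Qed.

Lemma projV0 : projV 0 = 0.
Proof. exact: (raddf0 \pi_(quotmod (Nalpha K n alpha))). Qed.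

Lemma projV_onto v : exists x, v = projV x.
Proof. by exists (repr v); rewrite /projV reprK. Qed.

(** As [word_step i] is idempotent, every word in its image is fixed by it. *)
Lemma coef_hpi_eq0 i x (y : word) :
  word_step i y != y -> coefM (hpi K i *: x) y = 0.
Proof.
move=> iy; rewrite [_ *: x]Malpha_scaleE /coefM /= sum_ffunE big1 // => w _.
rewrite !ffunE; case: eqP => [e|_]; last by rewrite scaler0.
by rewrite e word_step_idem eqxx in iy.
Qed.

(** Classes are compared on Y-words: a nonzero coefficient at [y] forces each generator fixing [w0]
    to fix [y] as well, hence [y = w0]. *)
Lemma projV_fixed (w0 : word) (x : M) :
    sorted leo (val w0) ->
    (forall i, word_step i w0 = w0 -> hpi K i *: projV x = projV x) ->
  projV x = hconst n (coefM x w0) *: projV (wordM w0).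
Proof.
move=> s0 fix_x; rewrite projVZ; apply/projV_eqP => y Yy.
rewrite [hconst _ _ *: _]hconst_scale /coefM !ffunE.
case: eqVneq => [->|yw0]; first by rewrite /GRing.scale /= mulr1.
rewrite scaler0; apply/eqP; apply: contraNT yw0 => xy; apply/eqP.
apply: fixed_Yword_sorted => // i i0; apply/eqP; apply: contraNT xy => iy.
have /projV_eqP /(_ y Yy) : projV (hpi K i *: x) = projV x.
  by rewrite -projVZ fix_x.
by rewrite coef_hpi_eq0 // /coefM => <-.
Qed.

Lemma wordM_span x : x = \sum_w hconst n (coefM x w) *: wordM w.
Proof.
apply/ffunP => u; transitivity ((\sum_w coefM x w *: basis_word K w) u).
  rewrite sum_ffunE (bigD1 u) //= !ffunE eqxx big1 ?addr0 => [|w wu].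
    by rewrite /GRing.scale /= mulr1.
  by rewrite !ffunE eq_sym (negPf wu) scaler0.
by congr (fun_of_fin _ u); apply: eq_bigr => w _; rewrite [RHS]hconst_scale.
Qed.

(** Membership in [U] spreads from [w0] to all words along the generators, and words span. *)
Lemma sorted_word_generates (w0 : word) (U : submodule V) :
  sorted leo (val w0) -> projV (wordM w0) \in U -> forall v, v \in U.
Proof.
move=> s0 U0 v; have [x ->] := projV_onto v.
have Uw w : projV (wordM w) \in U.
  apply: (word_ind_sorted (P := fun w => projV (wordM w) \in U) s0) => // i {}w Uw.
  by rewrite /wordM -hpi_word -projVZ rpredZ.
rewrite [x]wordM_span (big_morph projV projVD projV0).
by apply: rpred_sum => w _; rewrite -projVZ rpredZ.
Qed.

End Valpha.

(** * Direct sum decompositions and indecomposability *)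

(** The vector [h *: u - u = w - h *: w] lies in both summands, so it vanishes. *)
Lemma direct_sum_fixed (R : pzRingType) (M : lmodType R) (U W : submodule M) h u w :
    (forall v, v \in U -> v \in W -> v = 0) ->
    u \in U -> w \in W -> h *: (u + w) = u + w ->
  h *: u = u.
Proof.
move=> UW Uu Ww hv; apply/eqP; rewrite -subr_eq0; apply/eqP/UW.
  by rewrite rpredB ?rpredZ.
suff -> : h *: u - u = w - h *: w by rewrite rpredB ?rpredZ.
by apply/eqP; rewrite subr_eq addrAC eq_sym subr_eq addrC -hv scalerDr.
Qed.

Theorem theorem3p12 (K : fieldType) (n : nat) (alpha : seq nat) :
  is_composition n alpha ->
  @indecomposable (hecke0 K n) (Valpha K n alpha).
Proof.
move=> alphaP; have [w0 s0] := exists_sorted_word alphaP.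
have coef0 : coefM (wordM K w0) w0 = 1 by rewrite /coefM ffunE eqxx.
split.
  (* The class of [w0] is nonzero because [w0] is a Y-word. *)
  exists (projV (wordM K w0)); apply/eqP; rewrite -projV0.
  move/projV_eqP/(_ w0 (sorted_word_Yword alphaP s0)); rewrite coef0 /coefM ffunE.
  by move/eqP; rewrite oner_eq0.
move=> U W UW1 UW0; have [u Uu [w Ww e0]] := UW1 (projV (wordM K w0)).
have [x ex] := projV_onto u.
have eu : u = hconst n (coefM x w0) *: projV (wordM K w0).
  rewrite ex; apply: projV_fixed => // i i0; rewrite -ex.
  apply: (direct_sum_fixed UW0 Uu Ww).
  by rewrite -e0 projVZ hpi_word i0.
(* If the coefficient of [u] is 0, then [w] is the class of [w0] and [W] is everything; otherwise
   [u] rescales to that class and [U] is everything. The other summand then lies in both. *)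
have [c0|c0] := eqVneq (coefM x w0) 0.
  left=> v Uv; apply: UW0 => //; apply: (sorted_word_generates s0).
  suff -> : projV (wordM K w0) = w by [].
  by rewrite e0 eu c0 -[hconst n 0]/(0 : hecke0 K n) scale0r add0r.
right=> v Wv; apply: UW0 => //; apply: (sorted_word_generates s0).
suff -> : projV (wordM K w0) = hconst n (coefM x w0)^-1 *: u by rewrite rpredZ.
rewrite eu scalerA -[_ * _]hconstM mulVf // -[hconst n 1]/(1 : hecke0 K n).
by rewrite scale1r.
Qed.
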